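(* Let $F\in\mathbb{C}^{n\times N}$, let $\Pi\in\mathbb{R}^{N\times N}$ be a permutation matrix, let $\epsilon>0$, and let $Q\in\mathbb{C}^{n\times k}$, $R\in\mathbb{C}^{k\times N}$ be the rank-$k$ output of a rank-revealing QR factorization with column pivoting of $F$ with tolerance $\epsilon$; that is, $Q^*Q$ is the $k\times k$ identity, $R$ is upper triangular, $$\|F\Pi-QR\|_{\max}<\epsilon,$$ $|R(1,1)|\ge|R(2,2)|\ge\cdots\ge|R(k,k)|>0$, and $|R(i,i)|\ge|R(i,j)|$ for all $1\le i\le k$ and $i\le j\le N$. Let $\Gamma:=\mathrm{diag}(R(1,1),\dots,R(k,k))$. Let $I_m\subseteq\{1,\dots,n\}$ be a set of $m$ row indices and $H_m\in\mathbb{C}^{n\times m}$ (obtained by applying set-valued AAA to $Q\Gamma$ with tolerance $\epsilon$) be such that, with $\widetilde Q_m:=H_m\cdot Q(I_m,:)$, $$\|Q\Gamma-\widetilde Q_m\Gamma\|_{2,\infty}<\epsilon .$$ Then $$\|F\Pi-\widetilde Q_mR\|_{\max}\le\epsilon+\sqrt{k}\,\|Q\Gamma-\widetilde Q_m\Gamma\|_{2,\infty}\,\|\Gamma^{-1}R\|_{\max}<\epsilon\,(1+\sqrt{k}).$$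
   Context: For a matrix $M$, $M(I_m,:)$ denotes the submatrix of rows indexed by $I_m$; $\|M\|_{2,\infty}:=\max_i\|M(i,:)\|_2$ is the maximum Euclidean norm of the rows; $\|M\|_{\max}:=\max_{i,j}|M(i,j)|$. In the application, the rows of $F$ correspond to sample points $\zeta_i$ of a finite set in $\mathbb{C}$, the columns to component functions, and set-valued AAA applied to $Q\Gamma$ produces a barycentric rational interpolant with support points $\zeta_i$, $i\in I_m$, whose sampled matrix has the form $H_m\cdot(Q\Gamma)(I_m,:)=\big(H_m\cdot Q(I_m,:)\big)\Gamma$; only the displayed error bound for this approximation is used. *)

(* Defs.v *)
From HB Require Import structures.
From mathcomp Require Import all_boot all_order all_algebra.
From mathcomp Require Import spectral.
From mathcomp Require Import reals.
From mathcomp.real_closed Require Import complex.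

Set Implicit Arguments.
Unset Strict Implicit.
Unset Printing Implicit Defensive.

Import Order.TTheory GRing.Theory Num.Theory.
Local Open Scope ring_scope.

(* The order on K[i] is partial, so moduli are taken in K ([Normc.normc z] is
   the modulus of z as an element of K).  Maxima start from 0, so an empty
   matrix has norm 0. *)

Definition max_norm (K : realType) (m n : nat) (M : 'M[K[i]]_(m, n)) : K :=
  \big[Num.max/0]_(i < m) \big[Num.max/0]_(j < n) Normc.normc (M i j).

Definition two_inf_norm (K : realType) (m n : nat) (M : 'M[K[i]]_(m, n)) : K :=
  \big[Num.max/0]_(i < m) Num.sqrt (\sum_(j < n) Normc.normc (M i j) ^+ 2).

(* M(I,:), with the rows listed by increasing index. *)
Definition row_subset (T : Type) (m n : nat) (I : {set 'I_m})
    (M : 'M[T]_(m, n)) : 'M[T]_(#|I|, n) :=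
  rowsub (fun a : 'I_#|I| => enum_val a) M.

(* Diagonal entry A(i,i) of a k x n matrix with k <= n. *)
Definition diag_entry (T : Type) (k n : nat) (hkn : (k <= n)%N)
    (A : 'M[T]_(k, n)) (i : 'I_k) : T :=
  A i (widen_ord hkn i).

(* Main.v *)
(** Splitting the residual as [(F P - Q R) + (Q G - Qt G) (G^-1 R)] separates the
    factorization error from the approximation error.  An entry of the second
    product is a row of [Q G - Qt G] paired with a column of [G^-1 R]; bounding it
    by the 1-norm of the row times the max norm, and then the 1-norm by the 2-norm,
    costs the factor [sqrt k].  Column pivoting makes every entry of [G^-1 R] of
    modulus at most 1. *)
Require Import Defs.
From mathcomp Require Import all_boot all_order all_algebra.
From mathcomp Require Import spectral.
From mathcomp Require Import reals.
From mathcomp.real_closed Require Import complex.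

Set Implicit Arguments.
Unset Strict Implicit.
Unset Printing Implicit Defensive.

Import Order.TTheory GRing.Theory Num.Theory.
Local Open Scope ring_scope.
Local Open Scope sesquilinear_scope.

(** Cauchy-Schwarz against the all-ones vector, obtained by expanding the square into a double sum
    and applying [2ab <= a^2 + b^2] to each pair of terms. *)
Lemma sqr_sum_le (K : realFieldType) (n : nat) (x : 'I_n -> K) :
  (\sum_i x i) ^+ 2 <= n%:R * \sum_i x i ^+ 2.
Proof.
have AMGM (a b : K) : a * b *+ 2 <= a ^+ 2 + b ^+ 2.
  by rewrite -subr_ge0 addrAC -sqrrB sqr_ge0.
have sum_const (y : K) : \sum_(i < n) y = n%:R * y.
  by rewrite sumr_const card_ord mulr_natl.
(* Both sides are doubled so that the double sums compare termwise with no division by 2. *)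
rewrite -(ler_pMn2r (n := 2)) // expr2 mulr_suml -sumrMnl.
have -> : n%:R * (\sum_i x i ^+ 2) *+ 2
    = \sum_i \sum_j (x i ^+ 2 + x j ^+ 2).
  under [RHS]eq_bigr => i _ do rewrite big_split /= sum_const.
  by rewrite big_split /= -mulr_sumr sum_const mulr2n.
apply: ler_sum => i _.
by rewrite mulr_sumr -sumrMnl; apply: ler_sum => j _.
Qed.

(** Applied to the moduli along a row, this compares the 1-norm with the 2-norm and is the source of
    the factor [sqrt k]. *)
Lemma sum_le_sqrt_sum_sqr (K : rcfType) (n : nat) (x : 'I_n -> K) :
  \sum_i x i <= Num.sqrt n%:R * Num.sqrt (\sum_i x i ^+ 2).
Proof.
rewrite -sqrtrM ?ler0n // (le_trans (ler_norm _)) // -sqrtr_sqr.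
exact/ler_wsqrtr/sqr_sum_le.
Qed.

Lemma normc_ge0 (K : rcfType) (z : K[i]) : 0 <= Normc.normc z.
Proof. by case: z => a b; apply: sqrtr_ge0. Qed.

Lemma normc_sum (K : rcfType) (n : nat) (z : 'I_n -> K[i]) :
  Normc.normc (\sum_i z i) <= \sum_i Normc.normc (z i).
Proof.
elim/big_rec2: _ => [|i y w _ le_wy]; first by rewrite Normc.normc0.
by rewrite (le_trans (le_normcD _ _)) // lerD2l.
Qed.

(** The condition [0 <= c] accounts for the starting value 0 of the maxima, which is the norm of an
    empty matrix. *)
Lemma max_norm_leP (K : realType) (m n : nat) (M : 'M[K[i]]_(m, n)) (c : K) :
  0 <= c -> reflect (forall i j, Normc.normc (M i j) <= c) (max_norm M <= c).
Proof.
move=> c_ge0; apply: (iffP (bigmax_leP _ _ _ _)) => [[_ le_Mc] i j|le_Mc].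
  exact: le_trans (le_bigmax 0 (fun j => Normc.normc (M i j)) j) (le_Mc i isT).
by split=> // i _; apply/bigmax_leP.
Qed.

Lemma max_norm_ge0 (K : realType) (m n : nat) (M : 'M[K[i]]_(m, n)) :
  0 <= max_norm M.
Proof. exact: bigmax_ge_id. Qed.

Lemma le_max_norm (K : realType) (m n : nat) (M : 'M[K[i]]_(m, n)) i j :
  Normc.normc (M i j) <= max_norm M.
Proof. exact: (max_norm_leP _ (max_norm_ge0 M) (lexx _)). Qed.

Lemma max_normD (K : realType) (m n : nat) (A B : 'M[K[i]]_(m, n)) :
  max_norm (A + B) <= max_norm A + max_norm B.
Proof.
apply/max_norm_leP => [|i j]; first by rewrite addr_ge0 ?max_norm_ge0.
by rewrite mxE (le_trans (le_normcD _ _)) // lerD ?le_max_norm.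
Qed.

Lemma two_inf_norm_ge0 (K : realType) (m n : nat) (M : 'M[K[i]]_(m, n)) :
  0 <= two_inf_norm M.
Proof. exact: bigmax_ge_id. Qed.

Lemma max_normM (K : realType) (m k n : nat)
    (A : 'M[K[i]]_(m, k)) (B : 'M[K[i]]_(k, n)) :
  max_norm (A *m B) <= Num.sqrt k%:R * two_inf_norm A * max_norm B.
Proof.
have sqrtk_ge0 : 0 <= Num.sqrt k%:R :> K by apply: sqrtr_ge0.
apply/max_norm_leP => [|i j].
  by rewrite !mulr_ge0 ?two_inf_norm_ge0 ?max_norm_ge0.
have row_le : \sum_l Normc.normc (A i l) <= Num.sqrt k%:R * two_inf_norm A.
  rewrite (le_trans (sum_le_sqrt_sum_sqr _)) // ler_wpM2l //.
  exact: (le_bigmax 0 (fun i => Num.sqrt (\sum_l Normc.normc (A i l) ^+ 2))).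
rewrite mxE (le_trans (normc_sum _)) //.
apply: le_trans (ler_wpM2r (max_norm_ge0 B) row_le).
rewrite mulr_suml; apply: ler_sum => l _.
by rewrite Normc.normcM ler_wpM2l ?normc_ge0 ?le_max_norm.
Qed.

Lemma unitmx_diag (K : fieldType) (n : nat) (d : 'rV[K]_n) :
  (forall i, d 0 i != 0) -> diag_mx d \in unitmx.
Proof.
by move=> d_neq0; rewrite unitmxE det_diag unitfE; apply/prodf_neq0 => i _.
Qed.

Lemma max_norm_invmx_diag_le1 (K : realType) (k n : nat)
    (d : 'rV[K[i]]_k) (R : 'M[K[i]]_(k, n)) :
    (forall i, d 0 i != 0) ->
    (forall i j, Normc.normc (R i j) <= Normc.normc (d 0 i)) ->
  max_norm (invmx (diag_mx d) *m R) <= 1.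
Proof.
move=> d_neq0 R_le; apply/max_norm_leP => // i j.
have nd_gt0 : 0 < Normc.normc (d 0 i).
  rewrite lt_def normc_ge0 andbT; apply: contraNneq (d_neq0 i).
  by move/Normc.eq0_normc->.
(* Scaling by the modulus of [d 0 i] avoids computing the inverse: entry [(i, j)] of
   [D (D^-1 R) = R], with [D = diag_mx d], turns the goal into the bound on [R i j]. *)
rewrite -(ler_pM2l nd_gt0) mulr1 -Normc.normcM.
have -> : d 0 i * (invmx (diag_mx d) *m R) i j = R i j; last exact: R_le.
have /matrixP/(_ i j) := mulKVmx (unitmx_diag d_neq0) R.
by rewrite mul_diag_mx mxE.
Qed.

Theorem mainTheorem3 (K : realType) (n N k : nat)
    (F : 'M[K[i]]_(n, N)) (P : 'M[K]_N) (eps : K)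
    (Q : 'M[K[i]]_(n, k)) (R : 'M[K[i]]_(k, N))
    (G : 'M[K[i]]_k)
    (I : {set 'I_n}) (H : 'M[K[i]]_(n, #|I|)) (Qt : 'M[K[i]]_(n, k))
    (k_gt0 : (0 < k)%N) (le_kN : (k <= N)%N)
    (P_perm : is_perm_mx P)
    (eps_gt0 : 0 < eps)
    (Q_orth : Q ^t* *m Q = 1%:M)
    (R_upper : forall (i : 'I_k) (j : 'I_N), (j < i)%N -> R i j = 0)
    (FPQR : max_norm (F *m map_mx (real_complex K) P - Q *m R) < eps)
    (R_diag_noninc : forall i j : 'I_k, (i <= j)%N ->
      Normc.normc (diag_entry le_kN R j) <= Normc.normc (diag_entry le_kN R i))
    (R_diag_last : forall i : 'I_k, i.+1 = k ->
      0 < Normc.normc (diag_entry le_kN R i))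
    (R_diag_dom : forall (i : 'I_k) (j : 'I_N), (i <= j)%N ->
      Normc.normc (R i j) <= Normc.normc (diag_entry le_kN R i))
    (G_def : G = diag_mx (\row_(i < k) diag_entry le_kN R i))
    (Qt_def : Qt = H *m row_subset I Q)
    (QG_approx : two_inf_norm (Q *m G - Qt *m G) < eps) :
  max_norm (F *m map_mx (real_complex K) P - Qt *m R)
    <= eps + Num.sqrt k%:R * two_inf_norm (Q *m G - Qt *m G)
             * max_norm (invmx G *m R)
    < eps * (1 + Num.sqrt k%:R).
Proof.
pose d := \row_(i < k) diag_entry le_kN R i.
(* Positivity is given only for the last diagonal entry, at index [k.-1]; monotonicity carries it to
   all the others. *)
have nd_gt0 (i : 'I_k) : 0 < Normc.normc (diag_entry le_kN R i).
  have last_lt : (k.-1 < k)%N by rewrite prednK.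
  have last_gt0 := R_diag_last (Ordinal last_lt) (prednK k_gt0).
  apply: lt_le_trans last_gt0 (R_diag_noninc _ _ _).
  by rewrite /= -ltnS prednK.
have d_neq0 i : d 0 i != 0.
  rewrite mxE; apply: contraTneq (nd_gt0 i) => ->.
  by rewrite Normc.normc0 ltxx.
(* Pivoting bounds the entries on and right of the diagonal; those below it vanish by
   triangularity. *)
have R_le i j : Normc.normc (R i j) <= Normc.normc (d 0 i).
  rewrite mxE; case: (leqP i j) => [/R_diag_dom//|/R_upper->].
  by rewrite Normc.normc0 normc_ge0.
have G_unit : G \in unitmx by rewrite G_def unitmx_diag.
have GR_le1 : max_norm (invmx G *m R) <= 1.
  by rewrite G_def max_norm_invmx_diag_le1.
have split_residual : F *m map_mx (real_complex K) P - Qt *m R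
    = (F *m map_mx (real_complex K) P - Q *m R)
      + (Q *m G - Qt *m G) *m (invmx G *m R).
  (* Since [G (G^-1 R) = R], the second product equals [Q R - Qt R], and [Q R] cancels. *)
  by rewrite mulmxBl -!mulmxA !mulKVmx // addrA subrK.
apply/andP; split.
  by rewrite split_residual (le_trans (max_normD _ _)) // lerD ?max_normM // ltW.
rewrite mulrDr mulr1 ltrD2l.
have sqrtk_gt0 : 0 < Num.sqrt k%:R :> K by rewrite sqrtr_gt0 ltr0n.
(* Dropping the factor [max_norm (invmx G *m R)] is only a weak inequality; strictness comes from
   [QG_approx] multiplied by [sqrt k], which is positive because [0 < k]. *)
apply: (@le_lt_trans _ _ (Num.sqrt k%:R * two_inf_norm (Q *m G - Qt *m G))).
  by rewrite ler_piMr // mulr_ge0 ?two_inf_norm_ge0 // ltW.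
by rewrite mulrC ltr_pM2r.
Qed.
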